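(* Let $n < \infty$ be a natural number, let $M, N$ be closed subsets of $\mathbb{R}^{n}$, and let $d$ be the usual (Euclidean) metric on $\mathbb{R}^n$. Let $f: M \to N$ be a surjection with the property that, for some fixed $\varepsilon > 0$, for all $x, y \in M$ we have $d(f(x),f(y)) < \varepsilon$ if and only if $d(x,y) < \varepsilon$. Suppose also that for all $x, y \in M$ with $x \neq y$ there is an element $z \in M$ with $d(x,z) > \varepsilon$ and $d(y,z) < \varepsilon$, and similarly that for all $u, v \in N$ with $u \neq v$ there is an element $w \in N$ with $d(u,w) > \varepsilon$ and $d(v,w) < \varepsilon$ (with the same $\varepsilon$ throughout). Then $f$ is a homeomorphism.
   Context: $M$ and $N$ carry the subspace topologies inherited from $\mathbb{R}^{n}$. The map $f$ is not assumed to be continuous or injective. *)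

(* Defs.v *)
From HB Require Import structures.
From mathcomp Require Import all_boot all_order all_algebra.
From mathcomp Require Import all_classical all_reals all_analysis.

Set Implicit Arguments.
Unset Strict Implicit.
Unset Printing Implicit Defensive.

Import Order.TTheory GRing.Theory Num.Theory.
Import numFieldNormedType.Exports.

Local Open Scope classical_set_scope.
Local Open Scope ring_scope.

(* The library norm on row vectors is the sup norm, so the Euclidean metric is
   defined here. Both metrics induce the canonical topology of 'rV[R]_n, hence
   [closed] keeps its usual meaning. *)
Definition eucl_dist (R : realType) (n : nat) (x y : 'rV[R]_n) : R :=
  Num.sqrt (\sum_(i < n) (x ord0 i - y ord0 i) ^+ 2).

Definition homeomorphism (X Y : topologicalType) (f : X -> Y) : Prop :=
  continuous f /\
  exists g : Y -> X, [/\ cancel f g, cancel g f & continuous g].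

(* Main.v *)
Require Import Defs.
From HB Require Import structures.
From mathcomp Require Import all_boot all_order all_algebra.
From mathcomp Require Import all_classical all_reals all_analysis.

Import Order.TTheory GRing.Theory Num.Theory.
Import numFieldNormedType.Exports.

Local Open Scope classical_set_scope.
Local Open Scope ring_scope.

Lemma eucl_distxx {R : realType} {n : nat} (x : 'rV[R]_n) : eucl_dist x x = 0.
Proof.
by rewrite /eucl_dist big1 ?sqrtr0// => i _; rewrite subrr expr0n.
Qed.

Lemma eucl_dist_coord {R : realType} {n : nat} (x y : 'rV[R]_n) (i : 'I_n) :
  `|x ord0 i - y ord0 i| <= eucl_dist x y.
Proof.
rewrite -sqrtr_sqr ler_wsqrtr// (bigD1 i)//= lerDl.
by apply: sumr_ge0 => j _; exact: sqr_ge0.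
Qed.

(** Links the Euclidean metric to the canonical topology: strict inequalities on [eucl_dist] become
    open conditions. *)
Lemma eucl_dist_continuousl {R : realType} {n : nat} (z : 'rV[R]_n) :
  continuous (fun x => eucl_dist x z).
Proof.
move=> x; apply: (@continuous_comp _ _ _
  (fun x : 'rV[R]_n => \sum_(i < n) (x ord0 i - z ord0 i) ^+ 2) Num.sqrt).
  apply: continuous_big; first exact: add_continuous.
  move=> i _ {}x.
  apply: (@continuous_comp _ _ _ (fun x : 'rV[R]_n => x ord0 i - z ord0 i)
    (fun t : R => t ^+ 2)); last exact: exprn_continuous.
  apply: continuousB; [exact: coord_continuous|exact: cst_continuous].
exact: sqrt_continuous.
Qed.

Lemma eucl_ball_nbhs {R : realType} {n : nat} (x z : 'rV[R]_n) (r : R) :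
  eucl_dist x z < r -> \forall y \near x, eucl_dist y z < r.
Proof. by move=> xz; exact: (cvgr_lt _ (eucl_dist_continuousl z x)). Qed.

Lemma eucl_coball_nbhs {R : realType} {n : nat} (x z : 'rV[R]_n) (r : R) :
  r < eucl_dist x z -> \forall y \near x, r < eucl_dist y z.
Proof. by move=> xz; exact: (cvgr_gt _ (eucl_dist_continuousl z x)). Qed.

(** Coordinates differ by at most the Euclidean distance, so the ball lies in a cube, a product of
    compact segments. *)
Lemma eucl_ball_sub_compact {R : realType} {n : nat} (z : 'rV[R]_n) (r : R) :
  exists2 K : set 'rV[R]_n, compact K &
    [set x | eucl_dist x z < r] `<=` K.
Proof.
exists [set x | forall i, `[z ord0 i - r, z ord0 i + r]%classic (x ord0 i)].
  by apply: (@rV_compact R n (fun i => `[z ord0 i - r, z ord0 i + r]%classic))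
    => i; exact: segment_compact.
move=> x /= xz i; rewrite /= in_itv/= -ler_distl.
exact: le_trans (eucl_dist_coord _ _ i) (ltW xz).
Qed.

Lemma set_val_continuous {T : topologicalType} (A : set T) :
  continuous (\val : A -> T).
Proof. exact: initial_continuous. Qed.

(* By local compactness it suffices that [f x] is the only cluster point of [f]
   at [x]: a cluster point [v <> f x] lies in [N], and a point [f z] that is
   eps-close to [f x] but more than eps away from [v] is impossible, since
   [f y] is eps-close to [f z] for all [y] near [x]. *)
Lemma eps_map_continuous {R : realType} {n : nat} {M N : set 'rV[R]_n}
  (closedN : closed N) (f : M -> N) (g : N -> M) (fgK : cancel g f)
  (eps : R) (eps_gt0 : 0 < eps)
  (f_eps : forall x y : M,
     eucl_dist (\val (f x)) (\val (f y)) < eps <->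
     eucl_dist (\val x) (\val y) < eps)
  (sepN : forall u v : N, u <> v ->
     exists w : N, eps < eucl_dist (\val u) (\val w) /\
       eucl_dist (\val v) (\val w) < eps) :
  continuous f.
Proof.
(* Being eps-close to [z] is an open condition on [M], and [f_eps] transports it to the images. *)
have near_f (x z : M) : eucl_dist (\val (f x)) (\val (f z)) < eps ->
    \forall y \near x, eucl_dist (\val (f y)) (\val (f z)) < eps.
  move=> /(f_eps x z).1 xz; near=> y; apply/(f_eps y z).2; near: y.
  exact: (set_val_continuous M x _ (eucl_ball_nbhs _ _ _ xz)).
apply: continuous_comp_initial => x.
have fx0 : eucl_dist (\val (f x)) (\val (f x)) < eps by rewrite eucl_distxx.
have [K cK sK] := eucl_ball_sub_compact (\val (f x)) eps.
set F := (\val \o f) @ x.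
have FF : ProperFilter F.
  by apply: fmap_proper_filter; exact: (@nbhs_pfilter M x).
have FK : F K by apply: filterS (near_f x x fx0) => y; exact: sK.
have FN : F N.
  by apply: (@filterE M (nbhs x)) => y; exact: set_mem (valP (f y)).
have cluster_eq v : cluster F v -> v = \val (f x).
  (* Every neighbourhood of [v] meets [N], because [N] belongs to [F]. *)
  move=> Fv; have Nv : N v.
    by apply: closedN => B vB; exact: Fv.
  pose v' : N := SigSub (mem_set Nv).
  apply: contrapT => vfx.
  have [|w [vw fxw]] := sepN v' (f x); first by move=> /(congr1 \val).
  (* Surjectivity enters here: [near_f] only handles balls centred at values of [f], so [w] is
     written as one. *)
  rewrite -(fgK w) in fxw vw.
  have [u [/= uw wu]] := Fv [set t | eucl_dist t (\val (f (g w))) < eps] _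
    (near_f x (g w) fxw) (eucl_coball_nbhs _ _ _ vw).
  by move: (lt_trans uw wu); rewrite ltxx.
(* A proper filter containing a compact set converges to its unique cluster point; compactness of
   [K] also provides that such a point exists. *)
apply: (@compact_cluster_set1 _ _ F K) => //.
- exact: filterS sK (eucl_ball_nbhs _ _ _ fx0).
- apply/seteqP; split=> [v /cluster_eq//|_ ->].
  by have [v [_ Fv]] := cK F _ FK; move: (Fv); rewrite {1}(cluster_eq v Fv).
Unshelve. all: by end_near. Qed.

(* A set coerces to the subtype of its elements, whose canonical topology is
   the subspace topology. *)
Theorem mainTheorem1 (R : realType) (n : nat) (M N : set 'rV[R]_n)
  (closedM : closed M) (closedN : closed N)
  (f : M -> N) (surjf : set_surj [set: M] [set: N] f)
  (eps : R) (eps_gt0 : 0 < eps)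
  (f_eps : forall x y : M,
     eucl_dist (\val (f x)) (\val (f y)) < eps <->
     eucl_dist (\val x) (\val y) < eps)
  (sepM : forall x y : M, x <> y ->
     exists z : M, eps < eucl_dist (\val x) (\val z) /\
       eucl_dist (\val y) (\val z) < eps)
  (sepN : forall u v : N, u <> v ->
     exists w : N, eps < eucl_dist (\val u) (\val w) /\
       eucl_dist (\val v) (\val w) < eps) :
  homeomorphism f.
Proof.
have f_inj : injective f.
  (* A point [z] far from [x] but close to [y] would have [f z] close to [f y = f x], forcing [z]
     close to [x]. *)
  move=> x y fxy; apply: contrapT => /sepM[z [xz /f_eps]].
  by rewrite -fxy => /f_eps /(lt_trans xz); rewrite ltxx.
have /choice[g fgK] v : exists x, f x = v.
  by have [x _ <-] := surjf v I; exists x.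
have gfK : cancel f g by move=> x; exact/f_inj/fgK.
split; first exact: (eps_map_continuous closedN f g fgK eps).
exists g; split=> //.
(* The hypotheses are symmetric under exchanging [f] with [g] and [M] with [N]; [sepM] now separates
   points of the codomain. *)
apply: (eps_map_continuous closedM g f gfK eps) => // u v.
by rewrite -f_eps !fgK.
Qed.
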